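(* Let $q=3^m$ with $m\ge 2$, let $n\ge 2$ be an integer written as $n=3^h s$ with $h\ge0$ and $\gcd(s,3)=1$, and let $a\in\mathbb{F}_q^*$. Then $H_n(a)=H(a)+h$.
   Context: $\mathbb{F}_q\subset\mathbb{F}_{q^n}$. $\mathrm{Tr}$ is the absolute trace $\mathbb{F}_q\to\mathbb{F}_3$, $\mathrm{Tr}(x)=\sum_{j=0}^{m-1}x^{3^j}$, and $\mathrm{Tr}_{q^n\to q}(x)=x+x^q+\dots+x^{q^{n-1}}$. With $\omega=e^{2\pi i/3}$, $e(c)=\omega^{\mathrm{Tr}(c)}$ for $c\in\mathbb{F}_q$ and $e_n(b)=\omega^{\mathrm{Tr}(\mathrm{Tr}_{q^n\to q}(b))}$ for $b\in\mathbb{F}_{q^n}$. Define $K(a)=\sum_{x\in\mathbb{F}_q}e(x+a/x)$ and $K_n(a)=\sum_{x\in\mathbb{F}_{q^n}}e_n(x+a/x)$, where $a/x=a\,x^{Q-2}$ in a field of order $Q$ (so the term $x=0$ contributes $1$). $H(a)$ is the largest $k$ with $3^k\mid K(a)$ and $H_n(a)$ the largest $k$ with $3^k\mid K_n(a)$, with the convention that if $K(a)=0$ then $H(a)=m$, and if $K_n(a)=0$ then $H_n(a)=mn$. *)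

(* Defs.v *)
From HB Require Import structures.
From mathcomp Require Import all_boot all_order all_algebra all_field.
Set Implicit Arguments. Unset Strict Implicit. Unset Printing Implicit Defensive.
Import Order.TTheory GRing.Theory Num.Theory.
Local Open Scope ring_scope.

(* Absolute trace F_{3^m} -> F_3 : Tr(x) = sum_{j<m} x^(3^j) (computed in any
   ring R; for R a field of order 3^m its values lie in the prime field F_3). *)
Definition absTr {R : pzRingType} (m : nat) (x : R) : R :=
  \sum_(j < m) x ^+ (3 ^ j)%N.

Definition relTr {R : pzRingType} (q n : nat) (x : R) : R :=
  \sum_(j < n) x ^+ (q ^ j)%N.

(* An element t of the prime field F_3 = {0,1,2} viewed as the exponent
   in {0,1,2}. *)
Definition f3_exp {R : pzRingType} (t : R) : nat :=
  if t == 0 then 0%N else if t == 1 then 1%N else 2%N.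

Definition e_chr {F : finFieldType} (w : algC) (m : nat) (c : F) : algC :=
  w ^+ f3_exp (absTr m c).

Definition e_chr_n {L : finFieldType} (w : algC) (m n : nat) (b : L) : algC :=
  w ^+ f3_exp (absTr m (relTr (3 ^ m)%N n b)).

(* K(a) = sum_{x in F_q} e(x + a/x); a/x = a * x^-1, and x^-1 = 0 at x = 0. *)
Definition Kloost {F : finFieldType} (w : algC) (m : nat) (a : F) : algC :=
  \sum_(x : F) e_chr w m (x + a / x).

Definition Kloost_n {F L : finFieldType} (iota : {rmorphism F -> L})
    (w : algC) (m n : nat) (a : F) : algC :=
  \sum_(x : L) e_chr_n w m n (x + iota a / x).

Definition dvd3 (k : nat) (z : algC) : Prop := (z / 3%:R ^+ k) \in Aint.

Definition is_val3 (M : nat) (z : algC) (k : nat) : Prop :=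
  if z == 0 then k = M
  else dvd3 k z /\ (forall j : nat, dvd3 j z -> (j <= k)%N).

(* Main.v *)
(* For a monic polynomial [f] over [F_q] with [f(0) <> 0] put
   [chi f = e(s + a t)], where [s] is the sum of the roots of [f] and [t] the
   sum of their inverses.  This is multiplicative, and its sum over the monic
   [f] of degree [d] is [1], [K(a) - 1], [q] for [d = 0, 1, 2] and [0] for
   [d >= 3].  Comparing with the factorization into irreducibles gives Newton
   identities, which say that [K_n(a) = 1 - tr(A^n)] for an integer 2 x 2
   matrix [A] of trace [1 - K(a)] and determinant [q].  Hence
   [K_n(a) + q^n = det(1 - A^n)] and, factoring [1 - A^n], its 3-adic valuation
   exceeds that of [K(a) + q] by exactly [h].  Finally [K(a)] is [q - 3B] with
   [0 < B < q/2], so it is [0] or has valuation less than [m], and in both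
   cases [H(a)] is the valuation of [K(a) + q]. *)

Require Import Defs.
From HB Require Import structures.
From mathcomp Require Import all_boot all_order all_algebra all_field.
From mathcomp Require Import ring zify.
Import GRing.Theory Num.Theory.
Local Open Scope ring_scope.
Set Implicit Arguments.
Unset Strict Implicit.

(** * Determinants of 2 x 2 matrices and 3-adic valuations *)

Lemma det_mx2 (R : comNzRingType) (A : 'M[R]_2) :
  \det A = A 0 0 * A 1 1 - A 0 1 * A 1 0.
Proof.
rewrite (expand_det_row _ ord0) big_ord_recl big_ord1 /cofactor !det_mx11 !mxE.
have -> : lift ord0 (0 : 'I_1) = (1 : 'I_2) by apply: val_inj.
have -> : lift (1 : 'I_2) (0 : 'I_1) = (0 : 'I_2) by apply: val_inj.
rewrite /= expr0 expr1; ring.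
Qed.

Lemma mxtrace2 (R : comNzRingType) (A : 'M[R]_2) : \tr A = A 0 0 + A 1 1.
Proof.
rewrite /mxtrace big_ord_recl big_ord1.
by have -> : lift ord0 (0 : 'I_1) = (1 : 'I_2) by apply: val_inj.
Qed.

Lemma det_linear_mx2 (R : comNzRingType) (A : 'M[R]_2) (u v : R) :
  \det (u%:M + v *: A) = u ^+ 2 + u * v * \tr A + v ^+ 2 * \det A.
Proof. rewrite !det_mx2 mxtrace2 !mxE /=; ring. Qed.

(** Cayley-Hamilton in dimension 2, checked on the four entries. *)
Lemma sqr_mx2 (R : comNzRingType) (A : 'M[R]_2) :
  A * A = \tr A *: A - (\det A)%:M.
Proof.
apply/matrixP => i j; rewrite det_mx2 mxtrace2 !mxE big_ord_recl big_ord1.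
have -> : lift ord0 (0 : 'I_1) = (1 : 'I_2) by apply: val_inj.
have ord2E (k : 'I_2) : (k == 0) || (k == 1) by case: k => [[|[|]]].
by case/orP: (ord2E i) => /eqP ->; case/orP: (ord2E j) => /eqP ->;
  rewrite /= ?mulr1n ?mulr0n; ring.
Qed.

Lemma det_mxX (R : comNzRingType) k (A : 'M[R]_k.+1) n :
  \det (A ^+ n) = \det A ^+ n.
Proof.
elim: n => [|n IHn]; first by rewrite !expr0 det1.
by rewrite !exprS det_mulmx IHn.
Qed.

Lemma det_one_sub_mx2 (R : comNzRingType) (A : 'M[R]_2) :
  \det (1 - A) = 1 - \tr A + \det A.
Proof.
have -> : 1 - A = (1 : R)%:M + (-1) *: A by rewrite scaleN1r.
rewrite det_linear_mx2; ring.
Qed.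

Lemma mxtrace_exp_rec (R : comNzRingType) (A : 'M[R]_2) n :
  \tr (A ^+ n.+2) = \tr A * \tr (A ^+ n.+1) - \det A * \tr (A ^+ n).
Proof.
rewrite 2!exprS mulrA sqr_mx2 mulrBl raddfB /= -scalerAl linearZ /= -exprS.
by rewrite -mulmxE mul_scalar_mx linearZ.
Qed.

Lemma exp_mx2_idem (R : comNzRingType) (A : 'M[R]_2) n :
  \tr A = 1 -> \det A = 0 -> A ^+ n.+1 = A.
Proof.
move=> trA detA; elim: n => [|n IHn]; first by rewrite expr1.
by rewrite exprS IHn sqr_mx2 trA detA scale1r raddf0 subr0.
Qed.

(** [A] is idempotent by Cayley-Hamilton, so the sum collapses to [1 + (s - 1) A]. This is the
    situation modulo 3. *)
Lemma det_geom_mx2_idem (R : comNzRingType) (A : 'M[R]_2) s :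
  (0 < s)%N -> \tr A = 1 -> \det A = 0 -> \det (\sum_(i < s) A ^+ i) = s%:R.
Proof.
case: s => // s _ trA detA; rewrite big_ord_recl expr0.
have -> : \sum_(i < s) A ^+ lift ord0 i = s%:R *: A.
  rewrite (eq_bigr (fun=> A)) => [|i _].
    by rewrite sumr_const card_ord scaler_nat.
  by rewrite lift0 exp_mx2_idem.
rewrite (_ : 1 = (1 : R)%:M) // det_linear_mx2 trA detA -natr1; ring.
Qed.

Lemma eqF3P (x y : int) : (x%:~R == y%:~R :> 'F_3) = (3 %| x - y)%Z.
Proof.
by rewrite -subr_eq0 -rmorphB /= -(@dvdz_pcharf _ 3) ?pchar_Fp.
Qed.

Lemma eqF3_0 (x : int) : (x%:~R == 0 :> 'F_3) = (3 %| x)%Z.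
Proof. by rewrite -[x in RHS]subr0 -eqF3P. Qed.

(** Modulo 3 the matrix is idempotent. This passes the trace hypothesis from [A] to [A ^+ 3] in the
    induction below. *)
Lemma mxtrace_exp_mod3 (A : 'M[int]_2) n :
  (3 %| \tr A - 1)%Z -> (3 %| \det A)%Z -> (0 < n)%N ->
  (3 %| \tr (A ^+ n) - 1)%Z.
Proof.
rewrite -eqF3P -eqF3_0 => /eqP trA /eqP detA; case: n => // n _.
rewrite -eqF3P -trA -!trace_map_mx.
rewrite rmorphXn /= exp_mx2_idem // ?trace_map_mx ?det_map_mx ?detA //.
Qed.

Lemma det_geom_mx2_mod3 (A : 'M[int]_2) s :
  (3 %| \tr A - 1)%Z -> (3 %| \det A)%Z -> (0 < s)%N ->
  (3 %| \det (\sum_(i < s) A ^+ i) - s%:Z)%Z.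
Proof.
rewrite -eqF3P -eqF3_0 => /eqP trA /eqP detA s_gt0.
rewrite -eqF3P -det_map_mx rmorph_sum /=.
rewrite (eq_bigr (fun i : 'I_s => map_mx intr A ^+ i)) => [|i _].
  by rewrite det_geom_mx2_idem // ?trace_map_mx ?det_map_mx.
by rewrite rmorphXn.
Qed.

Lemma logn_absz_coprime (z : int) : ~~ (3 %| z)%Z -> logn 3 `|z| = 0%N.
Proof. by move=> z3; rewrite lognE /= -[3%N]/(absz 3) -dvdzE (negPf z3) andbF.
  Qed.

Lemma logn_abszM (y z : int) : y != 0 -> z != 0 ->
  logn 3 `|y * z| = (logn 3 `|y| + logn 3 `|z|)%N.
Proof. by move=> y0 z0; rewrite abszM lognM ?absz_gt0. Qed.

Lemma det_one_subX (A : 'M[int]_2) n :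
  \det (1 - A ^+ n) = \det (1 - A) * \det (\sum_(i < n) A ^+ i).
Proof. by rewrite -det_mulmx -opprB subrX1 -mulNr opprB. Qed.

(** Cayley-Hamilton makes [1 + A + A ^+ 2] linear in [A]. Working modulo 9 shows that its
    determinant has exactly one factor 3. *)
Lemma det_geom3 (A : 'M[int]_2) :
  (3 %| \tr A - 1)%Z -> (9 %| \det A)%Z ->
  (9 %| \det (\sum_(i < 3) A ^+ i) - 3)%Z.
Proof.
move=> /dvdzP[u trA] /dvdzP[r detA].
have -> : \sum_(i < 3) A ^+ i = (1 - \det A)%:M + (1 + \tr A) *: A.
  rewrite !big_ord_recl big_ord0 expr0 expr1 expr2 sqr_mx2 scalerDl scale1r.
  rewrite addr0 raddfB /= -[1%:M]/(1 : 'M[int]_2) -!addrA; congr (1 + _).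
  by rewrite [RHS]addrC addrA.
rewrite det_linear_mx2 detA.
have -> : \tr A = u * 3 + 1 by rewrite -trA subrK.
by apply/dvdzP; exists (u ^+ 2 + u + 9 * r ^+ 2 + 3 * u * r); ring.
Qed.

(** Base case: the geometric sum of length [s] has determinant [s] modulo 3, a unit. Each induction
    step replaces [A] by [A ^+ 3], and the factor [1 + A + A ^+ 2] of [1 - A ^+ 3] contributes
    valuation exactly 1. *)
Lemma logn_det_one_subX (A : 'M[int]_2) h s :
  (3 %| \tr A - 1)%Z -> (9 %| \det A)%Z -> \det (1 - A) != 0 ->
  coprime s 3 ->
  logn 3 `|\det (1 - A ^+ (3 ^ h * s))| = (logn 3 `|\det (1 - A)| + h)%N.
Proof.
have d39 (z : int) : (9 %| z)%Z -> (3 %| z)%Z by apply: dvdz_trans.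
move=> trA detA nz co_s; have s_gt0: (0 < s)%N by case: s co_s.
elim: h A trA detA nz => [|h IHh] A trA detA nz.
  have co_geom: ~~ (3 %| \det (\sum_(i < s) A ^+ i))%Z.
    have := det_geom_mx2_mod3 trA (d39 _ detA) s_gt0.
    move=> geomA; apply/negP => dvd_geom; move: (rpredB dvd_geom geomA).
    by rewrite opprB addrC subrK dvdzE /= => s3; move: co_s;
      rewrite coprime_sym prime_coprime ?s3.
  rewrite mul1n addn0 det_one_subX logn_abszM //; last first.
    by apply: contraNneq co_geom => ->.
  by rewrite (logn_absz_coprime co_geom) addn0.
have geomA := det_geom3 trA detA.
have dvd_geom : (3 %| \det (\sum_(i < 3) A ^+ i))%Z.
  by have := rpredD (d39 _ geomA) (dvdzz 3); rewrite subrK.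
have [r geomE] := dvdzP dvd_geom.
have co_r : ~~ (3 %| r)%Z.
  apply/negP => /dvdzP[t rE]; move: geomA; rewrite geomE rE => /dvdzP[u]; lia.
have r0 : r != 0 by apply: contraNneq co_r => ->.
have val_geom : logn 3 `|\det (\sum_(i < 3) A ^+ i)| = 1%N.
  by rewrite geomE logn_abszM // (logn_absz_coprime co_r).
have nz_geom : \det (\sum_(i < 3) A ^+ i) != 0 by rewrite geomE mulf_neq0.
rewrite expnS -mulnA exprM IHh.
- by rewrite det_one_subX logn_abszM // val_geom -addnA add1n.
- exact: mxtrace_exp_mod3 (d39 _ detA) _.
- by rewrite det_mxX !exprS; apply: dvdz_mulr.
- by rewrite det_one_subX mulf_neq0.
Qed.

(** * Monic polynomials over a finite field *)

Section Monics.
Context {F : finFieldType}.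
Implicit Types f g P Q : {poly F}.

Definition monics (d : nat) : seq {poly F} :=
  [seq 'X^d + polyn p | p : {poly_d F}].

Lemma uniq_monics d : uniq (monics d).
Proof.
apply/dinjectiveP => p r _ _ /addrI; exact: val_inj.
Qed.

Lemma mem_monics d f : (f \in monics d) = (f \is monic) && (size f == d.+1).
Proof.
apply/imageP/andP => [[p _ ->]|[mf /eqP sf]].
  have lt_p : (size (polyn p) < size ('X^d : {poly F}))%N.
    by rewrite size_polyXn ltnS size_npoly.
  by rewrite monicE lead_coefDl // lead_coefXn size_polyDl // size_polyXn.
have le_sf : (size (f - 'X^d)%R <= d)%N.
  have lcf : f`_d = 1 by move/monicP: mf; rewrite /lead_coef sf.
  apply/leq_sizeP => j; rewrite leq_eqVlt coefB coefXn => /orP[/eqP <-|lt_dj].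
    by rewrite lcf eqxx subrr.
  by rewrite nth_default ?sf //= gtn_eqF // subrr.
by exists (npolyp d (f - 'X^d)); rewrite ?npolypK // addrC subrK.
Qed.

Lemma monics0 : perm_eq (monics 0) [:: 1].
Proof.
apply: uniq_perm; rewrite ?uniq_monics // => f; rewrite mem_monics inE.
apply/andP/eqP => [[mf /eqP sf]|->]; last by rewrite monic1 size_poly1.
by have := sf; move/eqP/size_poly1P => [c _ fE]; move/monicP: mf;
  rewrite fE lead_coefC => ->.
Qed.

Lemma perm_monics_dvdp d e Q : Q \in monics e ->
  perm_eq [seq f <- monics d | Q %| f]
    (if (e <= d)%N then [seq Q * g | g <- monics (d - e)] else [::]).
Proof.
rewrite mem_monics => /andP[mQ /eqP sQ].
have nzQ := monic_neq0 mQ.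
apply: uniq_perm; first by rewrite filter_uniq ?uniq_monics.
  by case: ifP => // _; rewrite map_inj_uniq ?uniq_monics //; apply: mulfI.
move=> f; rewrite mem_filter mem_monics.
apply/idP/idP => [/and3P[/dvdpP[g fE] mf /eqP sf]|].
  have mg : g \is monic by rewrite -(monicMr _ mQ) -fE.
  have sg : (size g + e = d.+1)%N.
    by rewrite -sf fE size_Mmonic ?monic_neq0 // sQ addnS.
  have g_gt0 : (0 < size g)%N by rewrite size_poly_gt0 monic_neq0.
  have le_ed : (e <= d)%N by lia.
  rewrite le_ed; apply/mapP; exists g; last by rewrite fE mulrC.
  by rewrite mem_monics mg -subSn // -sg addnK eqxx.
case: ifP => // le_ed /mapP[g]; rewrite mem_monics => /andP[mg /eqP sg] ->.
by rewrite dvdp_mulr // monicMl // mg size_monicM ?monic_neq0 // sQ sg addnS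
  addSn subnKC //= eqxx.
Qed.

(** A monic divisor of least positive degree is irreducible. *)
Lemma monic_irreducible_divisor f : (1 < size f)%N ->
  exists e, exists2 P, P \in monics e & irreducible_poly P /\ P %| f.
Proof.
move=> sf; have nzf : f != 0 by rewrite -size_poly_gt0 ltnW.
have monic_scale g : g != 0 -> (lead_coef g)^-1 *: g \is monic.
  by move=> nzg; rewrite monicE lead_coefZ mulVf ?lead_coef_eq0.
have eqp_scale_lead g : g != 0 -> (lead_coef g)^-1 *: g %= g.
  by move=> nzg; rewrite eqp_scale // invr_eq0 lead_coef_eq0.
(* [good e] refers to degree [e.+1], which keeps constant divisors out of the minimization. *)
pose good e := has (fun g => g %| f) (monics e.+1).
have mem_good g : (1 < size g)%N -> g %| f -> good (size g).-2.
  move=> sg dvd_gf; have nzg : g != 0 by rewrite -size_poly_gt0 ltnW.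
  apply/hasP; exists ((lead_coef g)^-1 *: g).
    by rewrite mem_monics monic_scale // (eqp_size (eqp_scale_lead _ nzg)) /=;
      case: (size g) sg => [|[]].
  by rewrite (eqp_dvdl _ (eqp_scale_lead _ nzg)).
have ex_good : exists e, good e by exists (size f).-2; apply: mem_good.
case: (ex_minnP ex_good) => e /hasP[P mP dvd_Pf] min_e; exists e.+1, P => //;
  split=> //.
move: mP; rewrite mem_monics => /andP[mP /eqP sP].
split; first by rewrite sP.
move=> g sg dvd_gP; have nzg : g != 0.
  by apply: contraTneq dvd_gP => ->; rewrite dvd0p monic_neq0.
have sg1 : (1 < size g)%N by rewrite ltn_neqAle eq_sym sg size_poly_gt0.
have := min_e _ (mem_good g sg1 (dvdp_trans dvd_gP dvd_Pf)) => le_eg.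
rewrite -dvdp_size_eqp // sP eqn_leq; have := dvdp_leq (monic_neq0 mP) dvd_gP.
rewrite sP => -> /=; case: (size g) sg1 le_eg => [|[]] //.
Qed.

Definition irreds e : seq {poly F} := [seq P <- monics e | irreducibleb P].

Lemma irredsP e P : reflect [/\ P \is monic, size P = e.+1 & irreducible_poly P]
  (P \in irreds e).
Proof.
rewrite mem_filter mem_monics; apply: (iffP and3P) => -[].
  by move=> /irreducibleP irrP mP /eqP sP.
by move=> mP sP irrP; split=> //; [apply/irreducibleP | apply/eqP].
Qed.

Lemma monic_irr_eqp P Q : P \is monic -> Q \is monic -> irreducible_poly P ->
  irreducible_poly Q -> P %| Q -> P = Q.
Proof.
move=> mP mQ [sP _] [_ irrQ] dvdPQ; apply/eqP.
by rewrite -eqp_monic // irrQ // gtn_eqF.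
Qed.

Lemma dvdp_exp_lt k P g : (1 < size P)%N -> g != 0 -> P ^+ k %| g ->
  (k < size g)%N.
Proof.
move=> sP nzg dvdPg; apply: leq_trans (dvdp_leq nzg dvdPg).
have nzP : P != 0 by rewrite -size_poly_gt0 ltnW.
have : (0 < size (P ^+ k)%R)%N by rewrite size_poly_gt0 expf_neq0.
have := size_exp P k; case: (size _) => // j /= -> _.
by rewrite ltnS leq_pmull //; case: (size P) sP => [|[]].
Qed.

(* [\sum_k (P ^+ k %| f)] is the multiplicity of [P] in [f]. *)
Lemma sum_dvdp_mul_irr N P Q g :
  P \is monic -> Q \is monic -> irreducible_poly P -> irreducible_poly Q ->
  g != 0 -> (size g <= N)%N ->
  (\sum_(1 <= k < N.+1) (P ^+ k %| Q * g)%R =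
   \sum_(1 <= k < N.+1) (P ^+ k %| g)%R + (P == Q))%N.
Proof.
move=> mP mQ irrP irrQ nzg sg; have [->|neqPQ] := eqVneq P Q; last first.
  rewrite addn0; apply: eq_bigr => k _; rewrite Gauss_dvdpr //.
  rewrite coprimep_expl // irreducible_poly_coprime //.
  by apply: contra neqPQ => dvdPQ; apply/eqP; apply: monic_irr_eqp.
have nzQ := monic_neq0 mQ.
have g_gt0 : (0 < size g)%N by rewrite size_poly_gt0.
have N_gt0 : (0 < N)%N by apply: leq_trans g_gt0 sg.
(* The term [k = 1] is the extra divisor, the others drop by one power, and the remaining term
   [k = N] is zero because [size g <= N]. *)
rewrite big_nat_recl // (eq_bigr (fun k => (Q ^+ k %| g)%R : nat)); last first.
  by move=> k _; rewrite exprS dvdp_mul2l.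
rewrite expr1 dvdp_mulIl /= addnC; congr addn.
rewrite big_nat_recr //= [X in (_ + X)%N](_ : _ = 0%N) ?addn0 //.
apply/eqP; rewrite eqb0; apply: contraL sg => dvdQg; rewrite -ltnNge.
by apply: dvdp_exp_lt dvdQg => //; case: irrQ.
Qed.

(** Strong induction on the size: dividing by an irreducible factor [Q] lowers only the multiplicity
    of [Q], and that by one. *)
Lemma sum_irreds_deg N f : f \is monic -> (size f <= N.+1)%N ->
  (\sum_(e < N.+1) \sum_(P <- irreds e) \sum_(1 <= k < N.+1) (P ^+ k %| f)%R * e
   = (size f).-1)%N.
Proof.
have [s] := ubnP (size f); elim: s f => // s IHs f lt_fs mf le_fN.
have nzf := monic_neq0 mf.
have [sf|sf] := leqP (size f) 1.
  have f1 : f = 1.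
    have /size_poly1P[c _ fE] : size f == 1%N by rewrite eqn_leq sf
      size_poly_gt0.
    by move/monicP: mf; rewrite fE lead_coefC => ->.
  rewrite f1 size_poly1 big1 // => e _;
    rewrite big_seq big1 // => P /irredsP[_ _ [sP _]].
  rewrite big_nat big1 // => k /andP[k_gt0 _].
  rewrite -(negbK (_ %| _)) (contra (@dvdp_exp_lt k P 1 sP (oner_neq0 _))) //.
  by rewrite size_poly1 -leqNgt.
have [e [Q mQ [irrQ /dvdpP[g fE]]]] := monic_irreducible_divisor sf.
have Qirr : Q \in irreds e.
  by move: mQ; rewrite mem_monics => /andP[mQ /eqP sQ]; apply/irredsP.
have [{}mQ sQ _] := irredsP _ _ Qirr.
have mg : g \is monic by rewrite -(monicMr _ mQ) -fE.
have nzg := monic_neq0 mg; have nzQ := monic_neq0 mQ.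
have sfE : size f = (size g + e)%N by rewrite fE size_Mmonic // sQ addnS.
have e_gt0 : (0 < e)%N by case: irrQ; rewrite sQ.
have lt_gf : (size g < size f)%N by rewrite sfE -[ltnLHS]addn0 ltn_add2l.
have le_gN : (size g <= N)%N by rewrite -ltnS (leq_trans lt_gf).
have le_eN : (e < N.+1)%N.
  move: le_fN; rewrite sfE; apply: leq_trans; rewrite -add1n leq_add2r.
  by rewrite size_poly_gt0.
transitivity (\sum_(i < N.+1) \sum_(P <- irreds i)
    (\sum_(1 <= k < N.+1) (P ^+ k %| g)%R * i + (P == Q) * i))%N.
  apply: eq_bigr => i _; rewrite big_seq [RHS]big_seq; apply: eq_bigr => P.
  move=> /irredsP[mP _ irrP].
  by rewrite -!big_distrl -mulnDl /= -sum_dvdp_mul_irr // fE mulrC.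
under eq_bigr do rewrite big_split.
rewrite big_split IHs //; last 2 first.
- exact: leq_trans lt_gf _.
- exact: leqW.
rewrite sfE; have -> : (size g + e).-1 = ((size g).-1 + e)%N.
  by rewrite -!subn1 addnC -addnBA 1?addnC // size_poly_gt0.
congr addn; rewrite (bigD1 (Ordinal le_eN)) //= (bigD1_seq Q) ?filter_uniq
  ?uniq_monics //=.
rewrite eqxx mul1n big1 ?addn0 => [|P /negPf -> //].
rewrite big1 ?addn0 // => i neq_ie;
  rewrite big_seq big1 // => P /irredsP[_ sP _].
case: eqP => // PQ; case/eqP: neq_ie; apply: val_inj.
by move: sP; rewrite PQ sQ => -[].
Qed.

End Monics.

(** * Newton identities for multiplicative functions of monic polynomials *)

Section EulerProduct.
Context {F : finFieldType} {R : comNzRingType} (chi : {poly F} -> R).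
Hypothesis chi1 : chi 1 = 1.
Hypothesis chiM : {in monic &, {morph chi : f g / f * g}}.

(** The coefficients of the L-series of [chi], the sum of [chi f * T ^ deg f]. *)
Definition char_sum (d : nat) : R := \sum_(f <- monics d) chi f.

(* The sum of [deg P * chi (P ^+ k)] over the prime powers [P ^+ k] of degree
   [j]; it does not depend on the bound [N] as long as [j <= N]. *)
Definition prime_power_sum (N j : nat) : R :=
  \sum_(e < N.+1) \sum_(P <- irreds e)
    \sum_(1 <= k < N.+1 | (e * k == j)%N) chi P ^+ k *+ e.

Lemma chiX P k : P \is monic -> chi (P ^+ k) = chi P ^+ k.
Proof.
move=> mP; elim: k => [|k IHk]; first by rewrite !expr0.
by rewrite !exprS chiM ?monic_exp // IHk.
Qed.

Lemma char_sum_dvdp d e Q : Q \in monics e ->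
  \sum_(f <- monics d | Q %| f) chi f =
  if (e <= d)%N then chi Q * char_sum (d - e) else 0.
Proof.
move=> mQ; rewrite -big_filter (perm_big _ (perm_monics_dvdp d mQ)).
case: ifP => _; last by rewrite big_nil.
rewrite big_map mulr_sumr big_seq [RHS]big_seq; apply: eq_bigr => g.
by move: mQ; rewrite !mem_monics => /andP[mQ _] /andP[mg _]; rewrite chiM.
Qed.

Lemma irred_expn_monics e (P : {poly F}) k :
  P \in irreds e -> P ^+ k \in monics (e * k).
Proof.
case/irredsP=> mP sP _; rewrite mem_monics monic_exp //=.
have : (0 < size (P ^+ k)%R)%N by rewrite size_poly_gt0 expf_neq0 ?monic_neq0.
by have := size_exp P k; rewrite sP; case: (size _) => //= n -> .
Qed.

(** The coefficient form of [T L' = L * (T L' / L)]: the degree of [f] is the sum of [deg P] over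
    the prime powers [P ^+ k] dividing [f], and for each of them [f] is [P ^+ k * g]. *)
Lemma mulrn_char_sum N d : (d <= N)%N ->
  char_sum d *+ d = \sum_(j < d.+1) prime_power_sum N j * char_sum (d - j).
Proof.
move=> le_dN; rewrite /char_sum -sumrMnl.
transitivity (\sum_(f <- monics d) \sum_(e < N.+1) \sum_(P <- irreds e)
    \sum_(1 <= k < N.+1) (if P ^+ k %| f then chi f *+ e else 0)).
  rewrite big_seq [RHS]big_seq; apply: eq_bigr => f; rewrite mem_monics.
  move=> /andP[mf /eqP sf]; have le_fN: (size f <= N.+1)%N by rewrite sf.
  rewrite -[X in _ *+ X]/(d.+1.-1) -sf -(sum_irreds_deg mf le_fN).
  rewrite -sumrMnr; apply: eq_bigr => e _; rewrite -sumrMnr;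
    apply: eq_bigr => P _.
  by rewrite -sumrMnr; apply: eq_bigr => k _; case: ifP; rewrite ?mul1n ?mul0n.
rewrite exchange_big /=.
under [RHS]eq_bigr => j _ do rewrite /prime_power_sum mulr_suml.
rewrite [RHS]exchange_big /=; apply: eq_bigr => e _.
under [RHS]eq_bigr => j _ do rewrite mulr_suml.
rewrite exchange_big [RHS]exchange_big /= big_seq [RHS]big_seq.
apply: eq_bigr => P irrP; have [mP _ _] := irredsP _ _ irrP.
under [RHS]eq_bigr => j _ do rewrite mulr_suml big_mkcond /=.
rewrite exchange_big [RHS]exchange_big /=; apply: eq_bigr => k _.
rewrite -big_mkcond /= sumrMnl (char_sum_dvdp d (irred_expn_monics k irrP)).
rewrite -big_mkcond /= chiX //; case: ifPn => le_d.
  rewrite (big_pred1 (Ordinal (le_d : (e * k < d.+1)%N))) ?mulrnAl //.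
rewrite mul0rn big_pred0 // => j; apply: contraNF le_d => /eqP ->.
by rewrite -ltnS.
Qed.

End EulerProduct.

(** * Irreducible polynomials and finite extensions *)

Section FiniteExtension.
Context {F L : finFieldType} (iota : {rmorphism F -> L}).
Local Notation q := #|F|.

(** The proof about [q] is an argument so that the map can carry a ring morphism structure. *)
Definition frobq of [pchar L].-nat q := fun x : L => x ^+ q.

Hypothesis q_pchar : [pchar L].-nat q.

Fact frobq_is_zmod_morphism : zmod_morphism (frobq q_pchar).
Proof.
move=> x y; apply/(addIr (y ^+ q)).
by rewrite /frobq -exprDn_pchar // subrK subrK.
Qed.

Fact frobq_is_monoid_morphism : monoid_morphism (frobq q_pchar).
Proof. by split=> [|x y]; rewrite /frobq ?expr1n ?exprMn. Qed.

HB.instance Definition _ :=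
  GRing.isZmodMorphism.Build L L (frobq q_pchar) frobq_is_zmod_morphism.
HB.instance Definition _ :=
  GRing.isMonoidMorphism.Build L L (frobq q_pchar) frobq_is_monoid_morphism.

(** [X^q - X] is the product of the [X - c] over [F], so all its roots in [L] come from [F]. *)
Lemma expq_fixed (y : L) : y ^+ q = y -> exists c, iota c = y.
Proof.
move=> yq; have : root (map_poly iota ('X^q - 'X)) y.
  by rewrite rmorphB /= map_polyXn map_polyX rootE !hornerE yq subrr.
rewrite finField_genPoly rmorph_prod /=.
under eq_bigr do rewrite rmorphB /= map_polyX map_polyC.
rewrite -(big_map iota xpredT (fun c => 'X - c%:P)) root_prod_XsubC.
by case/mapP=> c _ ->; exists c.
Qed.

Lemma poly_descent (f : {poly L}) : map_poly (frobq q_pchar) f = f ->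
  exists g : {poly F}, f = map_poly iota g.
Proof.
move=> frob_f; pose c i := odflt 0 [pick c | iota c == f`_i].
exists (\poly_(i < size f) c i); apply/polyP => i.
rewrite coef_map coef_poly; case: ltnP => [_|/leq_sizeP/(_ i (leqnn i))->];
  last exact: esym (rmorph0 iota).
rewrite /c; case: pickP => [y /eqP //|noc].
have [|y fy] := @expq_fixed f`_i; last by have := noc y; rewrite fy eqxx.
by rewrite -[in RHS]frob_f coef_map.
Qed.

Definition frob_orbit_poly (x : L) e : {poly L} :=
  \prod_(i < e) ('X - (x ^+ (q ^ i))%:P).

(** Frobenius permutes the factors cyclically, so the coefficients are fixed and descend to [F]. *)
Lemma frob_orbit_polyP (x : L) e : x ^+ (q ^ e) = x ->
  exists g : {poly F}, frob_orbit_poly x e = map_poly iota g.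
Proof.
move=> xe; apply: poly_descent; rewrite rmorph_prod /=.
under eq_bigr do rewrite rmorphB /= map_polyX map_polyC /= /frobq -exprM
  -expnSr.
rewrite /frob_orbit_poly; case: e xe => [|e] xe; first by rewrite !big_ord0.
rewrite big_ord_recr big_ord_recl /= xe expr1 mulrC; congr (_ * _).
Qed.

Lemma size_frob_orbit_poly (x : L) e : size (frob_orbit_poly x e) = e.+1.
Proof. by rewrite size_prod_XsubC [index_enum _]unlock -enumT size_enum_ord.
  Qed.

Lemma monic_frob_orbit_poly (x : L) e : frob_orbit_poly x e \is monic.
Proof. exact: monic_prod_XsubC. Qed.

Lemma root_frob_orbit_poly (x : L) e :
  (0 < e)%N -> root (frob_orbit_poly x e) x.
Proof.
case: e => // e _; rewrite /frob_orbit_poly big_ord_recl expn0 expr1.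
by rewrite rootM root_XsubC eqxx.
Qed.

(** Otherwise [P] and [f] are coprime over [F], hence over [L], and share no root. *)
Lemma irred_dvdp (P f : {poly F}) (x : L) : irreducible_poly P ->
  root (map_poly iota P) x -> root (map_poly iota f) x -> P %| f.
Proof.
move=> irrP Px fx; apply: contraTT fx; rewrite -irreducible_poly_coprime //.
by rewrite -(coprimep_map iota) => /coprimep_root/(_ Px).
Qed.

Lemma irred_root_uniq (P Q : {poly F}) (x : L) : P \is monic -> Q \is monic ->
  irreducible_poly P -> irreducible_poly Q ->
  root (map_poly iota P) x -> root (map_poly iota Q) x -> P = Q.
Proof.
move=> mP mQ irrP irrQ Px Qx; apply: monic_irr_eqp => //.
exact: irred_dvdp Px Qx.
Qed.

Lemma expn_iter_fixed (K : finFieldType) (x : K) N k :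
  x ^+ N = x -> x ^+ (N ^ k) = x.
Proof.
by move=> xN; elim: k => [|k IHk]; rewrite ?expr1 // expnSr exprM IHk.
Qed.

(** In the field [F[X] / P] of order [q ^ e], the class of [X] is fixed by the power [q ^ e]. *)
Lemma irred_dvd_Xq e k (P : {poly F}) : P \in irreds e ->
  P %| 'X^(q ^ (e * k)) - 'X.
Proof.
case/irredsP=> mP sP irrP.
pose mi : monic_irreducible_poly P := (irrP, mP).
pose K : finFieldType := {poly %/ P with mi}.
have cardK : #|K| = (q ^ e)%N by rewrite card_qfpoly sP.
have Xq : in_qpoly P ('X^(q ^ (e * k)) - 'X) = 0.
  apply/eqP; rewrite rmorphB rmorphXn /= subr_eq0; apply/eqP.
  rewrite expnM -cardK; apply: (@expn_iter_fixed K); exact: expf_card.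
have /(congr1 val) /= := Xq.
by rewrite -Pdiv.IdomainMonic.modpE (mk_monicE mi) // => /modp_eq0P.
Qed.

(** The orbit polynomial of length [i] descends to [F] and vanishes at [x], so [P] divides it. *)
Lemma irred_root_leq e (P : {poly F}) x i : P \in irreds e ->
  root (map_poly iota P) x -> (0 < i)%N -> x ^+ (q ^ i) = x -> (e <= i)%N.
Proof.
case/irredsP=> mP sP irrP Px i_gt0 xi; have [g gE] := frob_orbit_polyP xi.
have nzg : g != 0.
  by rewrite -(map_poly_eq0 iota) -gE monic_neq0 ?monic_frob_orbit_poly.
have gx : root (map_poly iota g) x by rewrite -gE root_frob_orbit_poly.
have := dvdp_leq nzg (irred_dvdp irrP Px gx).
by rewrite sP -(size_map_poly iota) -gE size_frob_orbit_poly.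
Qed.

(** [P] is the minimal polynomial, a monic polynomial of least degree vanishing at [x]; [X^#|L| - X]
    shows that some polynomial does. *)
Lemma exists_irred_root (x : L) : exists e, exists2 P, P \in irreds e &
  root (map_poly iota P) x.
Proof.
pose good e := has (fun f => root (map_poly iota f) x) (monics e).
have goodP (f : {poly F}) :
    f != 0 -> root (map_poly iota f) x -> good (size f).-1.
  move=> nzf fx; have nzl : (lead_coef f)^-1 != 0.
    by rewrite invr_eq0 lead_coef_eq0.
  apply/hasP; exists ((lead_coef f)^-1 *: f).
    rewrite mem_monics monicE lead_coefZ mulVf ?lead_coef_eq0 // size_scale //.
    by rewrite prednK ?size_poly_gt0 ?eqxx.
  by rewrite map_polyZ rootE hornerZ (rootP fx) mulr0.
have ex_good : exists e, good e.
  exists (size ('X^#|L| - 'X : {poly F})).-1; apply: goodP.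
    rewrite -size_poly_gt0 size_polyDl ?size_polyXn // size_polyN size_polyX.
    by rewrite ltnS finNzRing_gt1.
  rewrite rmorphB /= map_polyXn map_polyX rootE !hornerE.
  by rewrite expf_card subrr.
case: (ex_minnP ex_good) => e /hasP[P mP Px] min_e; exists e, P => //.
move: mP; rewrite mem_monics => /andP[mP /eqP sP].
have min_size (f : {poly F}) : f != 0 -> root (map_poly iota f) x ->
    (size P <= size f)%N.
  move=> nzf fx; rewrite sP -[ltnRHS]prednK ?size_poly_gt0 // ltnS.
  exact: min_e (goodP _ nzf fx).
have nzP := monic_neq0 mP.
apply/irredsP; split=> //; split.
  rewrite ltn_neqAle size_poly_gt0 nzP andbT;
    apply: contraL Px => /eqP/esym/eqP.
  case/size_poly1P=> c nzc ->; rewrite map_polyC rootC /= fmorph_eq0 //.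
move=> g sg dvd_gP; have /dvdpP[h PE] := dvd_gP.
have [nzh nzg] : h != 0 /\ g != 0.
  by apply/andP; rewrite -negb_or -mulf_eq0 -PE.
rewrite -dvdp_size_eqp // eqn_leq dvdp_leq //=.
move: Px; rewrite PE rmorphM /= rootM => /orP[hx|gx]; last by rewrite -PE;
  apply: min_size.
have := min_size _ nzh hx; rewrite PE size_mul //.
rewrite -size_poly_gt0 in nzg.
case: (size g) nzg sg => [|[|k]] // _ _; rewrite addnS /=.
by rewrite -[X in (_ <= X)%N -> _]addn0 leq_add2l.
Qed.

(** [P] divides [X^#|L| - X], a product of distinct linear factors over [L]. *)
Lemma card_irred_roots n e (P : {poly F}) : #|L| = (q ^ n)%N ->
  P \in irreds e -> (e %| n)%N -> #|[set x | root (map_poly iota P) x]| = e.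
Proof.
move=> cardL irrP /dvdnP[k nE]; have [mP sP _] := irredsP _ _ irrP.
have : map_poly iota P %| \prod_(x : L) ('X - x%:P).
  rewrite -finField_genPoly cardL nE mulnC -(map_polyXn iota) -(map_polyX iota)
    -rmorphB /=.
  by rewrite dvdp_map irred_dvd_Xq.
case/dvdp_prod_XsubC=> b eqP_P.
have -> : [set x | root (map_poly iota P) x] = [set x in mask b (index_enum L)].
  by apply/setP=> x; rewrite !inE (eqp_root eqP_P) root_prod_XsubC.
have := eqp_size eqP_P.
rewrite size_prod_XsubC size_map_poly sP => -[->].
by rewrite cardsE; apply/card_uniqP; rewrite mask_uniq ?index_enum_uniq.
Qed.

Lemma irred_root_frob e (P : {poly F}) x : P \in irreds e ->
  root (map_poly iota P) x -> x ^+ (q ^ e) = x.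
Proof.
move=> irrP Px; have := irred_dvd_Xq 1 irrP; rewrite muln1 -(dvdp_map iota).
rewrite rmorphB /= map_polyXn map_polyX => /dvdpP[g gE].
have : root ('X^(q ^ e) - 'X) x by rewrite gE rootM Px orbT.
by rewrite rootE !hornerE subr_eq0 => /eqP.
Qed.

Lemma irred_root_orbit e (P : {poly F}) x : P \in irreds e ->
  root (map_poly iota P) x -> map_poly iota P = frob_orbit_poly x e.
Proof.
move=> irrP Px; have [mP sP irrP'] := irredsP _ _ irrP.
have e_gt0 : (0 < e)%N by case: irrP'; rewrite sP.
have [g gE] := frob_orbit_polyP (irred_root_frob irrP Px).
rewrite gE; congr map_poly; apply/eqP.
have mg : g \is monic by rewrite -(map_monic iota) -gE monic_frob_orbit_poly.
rewrite -eqp_monic // -dvdp_size_eqp; last first.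
  by apply: irred_dvdp Px _ => //; rewrite -gE root_frob_orbit_poly.
by rewrite sP -(size_map_poly iota g) -gE size_frob_orbit_poly.
Qed.

(** A positive remainder of [n] modulo [e] would be a Frobenius period of [x] shorter than [e]. *)
Lemma irred_root_dvdn n e (P : {poly F}) x : #|L| = (q ^ n)%N ->
  P \in irreds e -> root (map_poly iota P) x -> (e %| n)%N.
Proof.
move=> cardL irrP Px; have xe := irred_root_frob irrP Px.
have e_gt0 : (0 < e)%N by case/irredsP: irrP => _ sP []; rewrite sP.
rewrite /dvdn -leqn0 leqNgt; apply/negP => r_gt0.
have : x ^+ (q ^ (n %% e)) = x.
  rewrite -[in RHS](expf_card x) cardL [in RHS](divn_eq n e) expnD exprM.
  by rewrite [(_ %/ _ * _)%N]mulnC expnM (expn_iter_fixed _ xe).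
move/(irred_root_leq irrP Px r_gt0); rewrite leqNgt ltn_mod e_gt0 //.
Qed.

(** The elements of [L] are grouped by minimal polynomial; each irreducible [P] of degree [e]
    dividing [n] has [e] roots. *)
Lemma sum_over_irreds (V : nmodType) n (G : L -> V) (H : nat -> {poly F} -> V) :
  #|L| = (q ^ n)%N -> (0 < n)%N ->
  (forall x e P, P \in irreds e -> root (map_poly iota P) x -> (e %| n)%N ->
     G x = H e P) ->
  \sum_x G x =
  \sum_(e < n.+1 | (e %| n)%N) \sum_(P <- irreds e) H e P *+ e.
Proof.
move=> cardL n_gt0 GH.
transitivity (\sum_x \sum_(e < n.+1 | (e %| n)%N)
    \sum_(P <- irreds e | root (map_poly iota P) x) H e P).
  apply: eq_bigr => x _; have [e [P irrP Px]] := exists_irred_root x.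
  have dvd_e := irred_root_dvdn cardL irrP Px.
  have [mP sP irrP'] := irredsP _ _ irrP.
  have le_e : (e < n.+1)%N by rewrite ltnS dvdn_leq.
  rewrite (bigD1 (Ordinal le_e)) //= [X in _ + X]big1 ?addr0; last first.
    move=> i /andP[_ neq_ie]; rewrite big_seq_cond big1 // => Q.
    case/andP=> /irredsP[mQ sQ irrQ] Qx; case/eqP: neq_ie; apply: val_inj.
    have PQ := irred_root_uniq mP mQ irrP' irrQ Px Qx.
    by move: sP; rewrite PQ sQ => -[].
  rewrite big_mkcond (bigD1_seq P) ?filter_uniq ?uniq_monics //= Px.
  rewrite (GH _ _ _ irrP Px dvd_e) big_seq_cond big1 ?addr0 // => Q.
  case/andP=> /irredsP[mQ sQ irrQ] neqQP; case: ifP => // Qx.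
  by case/eqP: neqQP; apply/esym/(irred_root_uniq mP mQ irrP' irrQ Px Qx).
rewrite exchange_big /=; apply: eq_bigr => e dvd_e.
rewrite (exchange_big_dep xpredT) //= big_seq [RHS]big_seq; apply: eq_bigr.
move=> P irrP; rewrite sumr_const -(card_irred_roots cardL irrP dvd_e) cardsE.
done.
Qed.

End FiniteExtension.

(** * Characters of Kloosterman sums *)

Section ExtremeCoefficients.
Context {K : fieldType}.
Implicit Types f g : {poly K}.

(* The coefficient below the leading one; the factor ['X] makes it [0], not
   [1], at the constant polynomial [1]. *)
Definition subcoef f : K := ('X * f)`_(size f).-1.

(** The logarithmic derivative of [f] at 0. *)
Definition logder0 f : K := f`_1 / f`_0.

Lemma subcoefM : {in monic &, {morph subcoef : f g / f * g >-> f + g}}.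
Proof.
move=> f g mf mg; have [nzf nzg] := (monic_neq0 mf, monic_neq0 mg).
have [d sf] : exists d, size f = d.+1 by exists (size f).-1;
  rewrite prednK ?size_poly_gt0.
have [e sg] : exists e, size g = e.+1 by exists (size g).-1;
  rewrite prednK ?size_poly_gt0.
rewrite /subcoef size_monicM // sf sg addnS addSn /=.
have lead (h : {poly K}) k : h \is monic -> size h = k.+1 -> ('X * h)`_k.+1 = 1.
  by move=> /monicP mh sh; rewrite coefXM /= -mh /lead_coef sh.
have high (h : {poly K}) k i : size h = k.+1 -> (k.+1 < i)%N -> ('X * h)`_i = 0.
  move=> sh lt_ki; rewrite coefXM; case: i lt_ki => //= i lt_ki.
  by rewrite nth_default // sh.
(* With a factor ['X] on each side this is the coefficient just below the top one of the product, to
   which only the indices [d] and [d.+1] contribute. *)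
have -> : ('X * (f * g))`_(d + e) = ('X * f * ('X * g))`_(d + e).+1.
  by rewrite -[in RHS]mulrA [RHS]coefXM /= [in RHS]mulrCA.
rewrite coefM; have lt_d : (d < (d + e).+2)%N by lia.
have lt_dS : (d.+1 < (d + e).+2)%N by lia.
rewrite (bigD1 (Ordinal lt_d)) //= (bigD1 (Ordinal lt_dS)) //=; last first.
  by rewrite -val_eqE /= gtn_eqF.
have -> : ((d + e).+1 - d = e.+1)%N by lia.
rewrite subSS addKn !lead // mulr1 mul1r big1 ?addr0 // => i.
rewrite -!val_eqE /= => /andP[/eqP ne1 /eqP ne2].
have [lt_id|le_di] := ltnP i d.
  by rewrite (high g e) ?mulr0 //; lia.
by rewrite (high f d) ?mul0r //; lia.
Qed.

Lemma subcoef1 : subcoef 1 = 0.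
Proof. by rewrite /subcoef size_poly1 coefXM. Qed.

Lemma subcoef_prod I (r : seq I) (z : I -> K) :
  subcoef (\prod_(i <- r) ('X - (z i)%:P)) = - \sum_(i <- r) z i.
Proof.
elim: r => [|i r IHr]; first by rewrite !big_nil oppr0 subcoef1.
rewrite !big_cons subcoefM ?monicXsubC ?monic_prod_XsubC // IHr opprD.
by rewrite /subcoef size_XsubC coefXM !coefE /= sub0r.
Qed.

Lemma logder0M f g : f`_0 != 0 -> g`_0 != 0 ->
  logder0 (f * g) = logder0 f + logder0 g.
Proof.
move=> nzf nzg; rewrite /logder0 !coefM !big_ord_recl !big_ord0 /=.
by field; apply/andP.
Qed.

Lemma logder0_prod I (r : seq I) (z : I -> K) : (forall i, z i != 0) ->
  logder0 (\prod_(i <- r) ('X - (z i)%:P)) = - \sum_(i <- r) (z i)^-1.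
Proof.
move=> nz_z; have nz0 s : (\prod_(i <- s) ('X - (z i)%:P))`_0 != 0.
  elim: s => [|i s IHs]; first by rewrite big_nil coef1 oner_eq0.
  by rewrite big_cons coef0M mulf_neq0 // !coefE /= sub0r oppr_eq0.
elim: r => [|i r IHr].
  by rewrite !big_nil /logder0 !coefE mul0r oppr0.
have nzi : ('X - (z i)%:P)`_0 != 0 by rewrite !coefE /= sub0r oppr_eq0.
rewrite !big_cons logder0M // IHr opprD; congr (_ + _).
by rewrite /logder0 !coefE /= sub0r subr0 mul1r invrN.
Qed.

End ExtremeCoefficients.

(** * The absolute trace and the additive character *)

Section AdditiveCharacter.
Context {F : finFieldType} {w : algC} {m : nat}.
Hypothesis m_gt0 : (0 < m)%N.
Hypothesis cardF : #|F| = (3 ^ m)%N.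
Hypothesis w3 : 3.-primitive_root w.
Local Notation e := (@e_chr F w m).
Local Notation Tr := (absTr m).

Lemma prim3_neq1 : w != 1.
Proof. by have := eq_prim_root_expr w3 1 0; rewrite expr1 expr0 => ->. Qed.

Lemma pchar3 : 3 \in [pchar F].
Proof. exact: card_finPcharP cardF _. Qed.

Lemma addr3_pchar3 (t : F) : t + t + t = 0.
Proof. by have := mulrn_pchar pchar3 t; rewrite !mulrSr mulr0n add0r. Qed.

Lemma addrr_pchar3 (t : F) : t + t = - t.
Proof. by apply/eqP; rewrite -addr_eq0 addr3_pchar3. Qed.

Lemma absTrD : {morph Tr : x y / x + y >-> x + y :> F}.
Proof.
move=> x y; rewrite /absTr -big_split; apply: eq_bigr => j _ /=.
by rewrite exprDn_pchar // pnatX pnatE ?pchar3.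
Qed.

Lemma absTr0 : Tr 0 = 0 :> F.
Proof. by apply: (addrI (Tr 0)); rewrite -absTrD !addr0. Qed.

Lemma absTrN (x : F) : Tr (- x) = - Tr x.
Proof. by apply/eqP; rewrite -addr_eq0 -absTrD addNr absTr0. Qed.

(** Cubing shifts the terms cyclically because [x ^+ (3 ^ m) = x]. *)
Lemma absTr_cube (x : F) : Tr x ^+ 3 = Tr x.
Proof.
rewrite /absTr -(pFrobenius_autE pchar3) rmorph_sum /=.
rewrite -(prednK m_gt0) big_ord_recr big_ord_recl /= addrC; congr (_ + _).
  by rewrite pFrobenius_autE -exprM -expnSr prednK // -cardF expf_card expr1.
by apply: eq_bigr => j _; rewrite pFrobenius_autE -exprM -expnSr.
Qed.

Lemma absTrP (x : F) : [\/ Tr x = 0, Tr x = 1 | Tr x = -1].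
Proof.
have : Tr x * (Tr x - 1) * (Tr x + 1) == 0.
  by have := absTr_cube x; set t := Tr x => t3; apply/eqP;
    rewrite -[RHS](subrr t) -{4}t3; ring.
rewrite !mulf_eq0 subr_eq0 addr_eq0 -orbA => /or3P[] /eqP ->; by constructor.
Qed.

Lemma f3_exp0 : f3_exp (0 : F) = 0%N. Proof. by rewrite /f3_exp eqxx. Qed.
Lemma f3_exp1 : f3_exp (1 : F) = 1%N.
Proof. by rewrite /f3_exp oner_eq0 eqxx. Qed.
Lemma f3_expN1 : f3_exp (-1 : F) = 2%N.
Proof.
by rewrite /f3_exp oppr_eq0 oner_eq0 -addrr_pchar3 -subr_eq0 addrK oner_eq0.
Qed.

Lemma e_chrD : {morph e : x y / x + y >-> x * y}.
Proof.
move=> x y; rewrite /e_chr absTrD -exprD.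
have w3E := prim_expr_order w3.
have [->|->|->] := absTrP x; first by rewrite add0r f3_exp0.
  have [->|->|->] := absTrP y;
    rewrite ?addr0 ?subrr ?f3_exp0 ?f3_exp1 ?f3_expN1 //.
  by rewrite addrr_pchar3 f3_expN1.
have [->|->|->] := absTrP y;
  rewrite ?addr0 ?addNr ?f3_exp0 ?f3_exp1 ?f3_expN1 //.
by rewrite -opprD addrr_pchar3 opprK f3_exp1 (exprD w 3 1) w3E mul1r.
Qed.

Lemma e_chr0 : e 0 = 1.
Proof. by rewrite /e_chr absTr0 f3_exp0. Qed.

Lemma e_chrMn x k : e (x *+ k) = e x ^+ k.
Proof.
by elim: k => [|k IHk]; rewrite ?mulr0n ?expr0 ?e_chr0 // mulrS exprS e_chrD
  IHk.
Qed.

(** Otherwise all these traces vanish, since [x -> - x] exchanges the values 1 and -1, and a nonzero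
    polynomial of low degree gets too many roots. *)
Lemma exists_absTr_eq1 (a : F) : (2 <= m)%N -> a != 0 ->
  exists x, Tr (x + a / x) = 1.
Proof.
move=> m_ge2 nza.
have [/existsP[x /eqP]|] := boolP [exists x, Tr (x + a / x) == 1];
  first by exists x.
rewrite negb_exists => /forallP noTr1.
have Tr0 x : Tr (x + a / x) = 0.
  have [//|/eqP|TrN1] := absTrP (x + a / x); first by rewrite (negPf (noTr1 x)).
  have /eqP[] := noTr1 (- x).
  by rewrite invrN mulrN -opprD absTrN TrN1 opprK.
pose N := (3 ^ m.-1)%N.
(* [p.[x] = x ^+ N * Tr (x + a / x)] for [x != 0], while [size p <= 2 * N + 1]
   is too small for [p] to vanish at all [3 * N - 1] units. *)
pose p : {poly F} :=
  \sum_(j < m) ('X^(3 ^ j + N) + (a ^+ (3 ^ j)) *: 'X^(N - 3 ^ j)).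
have le_jN (j : 'I_m) : (3 ^ j <= N)%N.
  by rewrite leq_exp2l // -ltnS prednK.
have p0 : p != 0.
  (* At 0 only [j = m.-1] survives, where the exponent [N - 3 ^ j] is 0; it gives [a ^+ N]. *)
  apply/eqP => /(congr1 (fun f => f.[0])); rewrite horner_sum horner0.
  have lt_m : (m.-1 < m)%N by rewrite prednK.
  rewrite (bigD1 (Ordinal lt_m)) //= big1 => [|j neq_j].
    rewrite !hornerE subnn expr0 mulr1 expr0n addn_eq0 !expn_eq0 /= add0r.
    by move/eqP; rewrite expf_eq0 (negPf nza) andbF.
  rewrite !hornerE !expr0n addn_eq0 !expn_eq0 /= subn_eq0 leq_exp2l //.
  have -> : (m.-1 <= j)%N = false.
    apply: contraNF neq_j => le_mj; rewrite -val_eqE /= eqn_leq le_mj andbT.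
    by rewrite -ltnS prednK.
  by rewrite mulr0 addr0.
have size_p : (size p <= (N + N).+1)%N.
  apply: leq_trans (size_sum _ _ _) _; apply/bigmax_leqP => j _.
  apply: leq_trans (size_polyD _ _) _; rewrite geq_max size_polyXn ltnS.
  rewrite leq_add2r le_jN /=; apply: leq_trans (size_scale_leq _ _) _.
  by rewrite size_polyXn ltnS (leq_trans (leq_subr _ _)) ?leq_addr.
pose rs := enum (predC1 (0 : F)).
have rs_root : all (root p) rs.
  apply/allP => x; rewrite mem_enum inE => nzx; rewrite rootE horner_sum.
  transitivity (x ^+ N * Tr (x + a / x) == 0); last by rewrite Tr0 mulr0 eqxx.
  congr (_ == _); rewrite absTrD /absTr -big_split mulr_sumr;
    apply: eq_bigr => j _ /=.
  rewrite !hornerE exprMn exprVn mulrDr addnC exprD; congr (_ + _).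
  by rewrite mulrCA expfB_cond // (negPf nzx) add0n le_jN.
have := max_poly_roots p0 rs_root (enum_uniq _).
rewrite -cardE cardC1 cardF => /leq_trans/(_ size_p).
have -> : (3 ^ m = 3 * N)%N by rewrite -expnS prednK.
have N_gt1 : (1 < N)%N by rewrite (@ltn_exp2l 3 0) // -ltnS prednK.
by move=> ?; exfalso; lia.
Qed.

(** * Kloosterman sums and their multiplicative function on monic polynomials *)

Section Kloosterman.
Variable a : F.
Hypothesis nza : a != 0.
Hypothesis m_ge2 : (2 <= m)%N.

(** [B] counts the [x] for which [x + a / x] has trace 1. By [x -> - x] as many give trace -1, and
    [x = 0] gives trace 0, so [2 * B < q]. Then [1 + w + w ^+ 2 = 0] turns
    [(w - 1) * B + (w ^+ 2 - 1) * B] into [- 3 * B]. *)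
Lemma Kloost_int : exists B : nat,
  [/\ (0 < B)%N, (2 * B < 3 ^ m)%N & Kloost w m a = (3 ^ m)%:R - (3 * B)%:R].
Proof.
pose A c := [set x : F | Tr (x + a / x) == c].
have cardAN : #|A (-1)| = #|A 1|.
  rewrite -(card_imset (A 1) (@oppr_inj F)); apply: eq_card => x.
  rewrite -[x in RHS]opprK mem_imset; last exact: oppr_inj.
  by rewrite !inE invrN mulrN -opprD absTrN eqr_oppLR.
have neqN11 : (-1 == 1 :> F) = false.
  by rewrite -addrr_pchar3 -subr_eq0 addrK oner_eq0.
exists #|A 1|; split.
- have [x Trx] := exists_absTr_eq1 m_ge2 nza.
  by apply/card_gt0P; exists x; rewrite inE Trx.
- rewrite mul2n -addnn -[X in (_ + X)%N]cardAN -cardF -cardsT.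
  have disjA : A 1 :&: A (-1) = set0.
    by apply/setP=> x; rewrite !inE; case: eqP => // ->; rewrite eq_sym neqN11.
  rewrite -cardsUI disjA cards0 addn0; apply: proper_card;
    rewrite properE subsetT /=.
  apply/subsetPn; exists 0; rewrite // !inE invr0 mulr0 addr0 absTr0 eq_sym
    oner_eq0 eq_sym.
  by rewrite oppr_eq0 oner_eq0.
pose ind c := \sum_(x : F) (Tr (x + a / x) == c)%:R : algC.
have indE c : ind c = #|A c|%:R.
  by rewrite /ind -natr_sum -sum1dep_card [in RHS]big_mkcond /=; congr _%:R.
have -> : Kloost w m a = \sum_(x : F) 1 + (w - 1) * ind 1 + (w ^+ 2 - 1) * ind
  (-1).
  rewrite /ind !mulr_sumr -!big_split; apply: eq_bigr => x _ /=.
  rewrite /e_chr; have [->|->|->] := absTrP (x + a / x).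
  - by rewrite f3_exp0 !(eq_sym 0) oppr_eq0 oner_eq0 !mulr0 !addr0.
  - by rewrite f3_exp1 eqxx eq_sym neqN11 /= expr1 mulr1n mulr0n; ring.
  - by rewrite f3_expN1 eqxx neqN11 /= mulr1n mulr0n; ring.
rewrite !indE cardAN sumr_const cardF.
have w_sum : 1 + w + w ^+ 2 = 0.
  apply/eqP; have : (w - 1) * (1 + w + w ^+ 2) == 0.
    apply/eqP; transitivity (w ^+ 3 - 1); first by ring.
    by rewrite (prim_expr_order w3) subrr.
  by rewrite mulf_eq0 subr_eq0 (negPf prim3_neq1).
rewrite natrM -[w ^+ 2](addKr (1 + w)) w_sum; ring.
Qed.

(* [subcoef f] is minus the sum of the roots of [f], and [logder0 f] is minus
   the sum of their inverses. *)
Definition kl_char (f : {poly F}) : algC :=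
  if f`_0 == 0 then 0 else e (- (subcoef f + a * logder0 f)).

Lemma kl_char1 : kl_char 1 = 1.
Proof.
by rewrite /kl_char coef1 oner_eq0 subcoef1 /logder0 !coef1 mul0r mulr0 addr0
  oppr0 e_chr0.
Qed.

Lemma kl_charM : {in monic &, {morph kl_char : f g / f * g}}.
Proof.
move=> f g mf mg; rewrite /kl_char coef0M mulf_eq0.
case: eqP => [|/eqP nzf]; first by rewrite mul0r.
case: eqP => [|/eqP nzg]; first by rewrite mulr0.
by rewrite /= -e_chrD subcoefM // logder0M // mulrDr addrACA opprD.
Qed.

Lemma exists_e_chr_neq1 : exists t, e t != 1.
Proof.
have [x Trx] := exists_absTr_eq1 m_ge2 nza; exists (x + a / x).
by rewrite /e_chr Trx f3_exp1 expr1 prim3_neq1.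
Qed.

Lemma sum_e_chr c : \sum_u e (u * c) = if c == 0 then (3 ^ m)%:R else 0.
Proof.
case: eqP => [->|/eqP nzc].
  under eq_bigr do rewrite mulr0 e_chr0.
  by rewrite sumr_const cardF.
have [t et] := exists_e_chr_neq1.
have shift : \sum_u e (u * c) = e t * \sum_u e (u * c).
  rewrite {1}(reindex_inj (addrI (t / c))) /= mulr_sumr; apply: eq_bigr => u _.
  by rewrite mulrDl divfK // e_chrD.
apply/eqP; have /eqP := shift;
  rewrite -subr_eq0 -{1}[X in X - _]mul1r -mulrBl mulf_eq0.
by rewrite subr_eq0 eq_sym (negPf et).
Qed.

Lemma kl_sum0 : char_sum kl_char 0 = 1.
Proof. by rewrite /char_sum (perm_big _ monics0) big_seq1 kl_char1. Qed.

(** For [c] nonzero [X - c] contributes [e (c + a / c)], and [X] contributes 0, whereas the term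
    [x = 0] of the Kloosterman sum is 1. *)
Lemma kl_sum1 : char_sum kl_char 1 = Kloost w m a - 1.
Proof.
have perm1 : perm_eq (monics 1) [seq 'X - c%:P | c : F].
  apply: uniq_perm; first exact: uniq_monics.
    by apply/dinjectiveP => c d _ _ /subrI/polyC_inj.
  move=> f; rewrite mem_monics; apply/andP/imageP => [[mf /eqP sf]|[c _ ->]].
    exists (- f`_0) => //; apply/polyP => i; rewrite !coefE.
    case: i => [|[|i]] /=; rewrite ?subr0 ?sub0r ?opprK //.
      by move/monicP: mf; rewrite /lead_coef sf.
    by rewrite nth_default ?sf.
  by rewrite monicXsubC size_XsubC.
rewrite /char_sum (perm_big _ perm1) big_map big_enum /=.
rewrite /Kloost [in RHS](bigD1 0) //= invr0 mulr0 addr0 e_chr0 [RHS]addrC addKr.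
rewrite (bigD1 0) //= {1}/kl_char !coefE subrr eqxx add0r;
  apply: eq_bigr => x nzx.
have -> : 'X - x%:P = \prod_(i < 1) ('X - x%:P) by rewrite big_ord1.
rewrite /kl_char subcoef_prod logder0_prod // !big_ord1 !coefE /= sub0r
  oppr_eq0 (negPf nzx).
by rewrite mulrN opprD !opprK.
Qed.

(** For [v] nonzero the value at [X^2 + u X + v] is [e (- u * (1 + a / v))]; summing over [u] kills
    every [v] except [- a], which gives [q]. *)
Lemma kl_sum2 : char_sum kl_char 2 = (3 ^ m)%:R.
Proof.
pose quad (p : F * F) : {poly F} := 'X^2 + p.1 *: 'X + p.2%:P.
have quad_coef p : (quad p)`_0 = p.2 /\ (quad p)`_1 = p.1.
  by rewrite /quad !coefE /=; split; rewrite ?mulr0 ?mulr1 ?addr0 ?add0r.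
have size_low (p : F * F) : (size (p.1 *: 'X + p.2%:P)%R < size ('X^2 : {poly
  F}))%N.
  rewrite size_polyXn ltnS (leq_trans (size_polyD _ _)) // geq_max.
  rewrite (leq_trans (size_scale_leq _ _)) ?size_polyX //.
  exact: leq_trans (size_polyC_leq1 _) _.
have perm2 : perm_eq (monics 2) [seq quad p | p : F * F].
  apply: uniq_perm; first exact: uniq_monics.
    apply/dinjectiveP => -[u v] [u' v'] _ _ eq_quad.
    have [/= v1 u1] := quad_coef (u, v); have [/= v2 u2] := quad_coef (u', v').
    by congr pair; [rewrite -u1 eq_quad | rewrite -v1 eq_quad].
  move=> f; rewrite mem_monics; apply/andP/imageP => [[mf /eqP sf]|[p _ ->]].
    exists (f`_1, f`_0) => //; apply/polyP => i; rewrite !coefE.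
    case: i => [|[|[|i]]] /=; rewrite ?mulr0 ?mulr1 ?addr0 ?add0r //.
      by move/monicP: mf; rewrite /lead_coef sf.
    by rewrite nth_default ?sf.
  rewrite /quad -addrA monicE lead_coefDl // lead_coefXn size_polyDl //.
  by rewrite size_polyXn.
have quad_char u v : kl_char (quad (u, v)) =
    if v == 0 then 0 else e (u * (- (1 + a / v))).
  have [/= v1 u1] := quad_coef (u, v); rewrite /kl_char v1; case: ifP => // _.
  rewrite /logder0 v1 u1 /subcoef.
  have -> : size (quad (u, v)) = 3%N.
    by rewrite /quad -addrA size_polyDl // size_polyXn.
  rewrite coefXM /= u1; congr e; ring.
rewrite /char_sum (perm_big _ perm2) big_map big_enum /=.
rewrite -(pair_big xpredT xpredT (fun u v => kl_char (quad (u, v)))) /=.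
rewrite exchange_big /= (bigD1 (- a)) ?oppr_eq0 //=.
under eq_bigr do rewrite quad_char oppr_eq0 (negPf nza).
rewrite sum_e_chr invrN mulrN divff // subrr oppr0 eqxx big1 ?addr0 // => v
  neq_va.
under eq_bigr do rewrite quad_char.
case: eqP => [_|/eqP nzv]; first by rewrite big1.
rewrite sum_e_chr oppr_eq0 -[1](divff nzv) -mulrDl mulf_eq0 invr_eq0 (negPf
  nzv) orbF.
by rewrite addr_eq0 (negPf neq_va).
Qed.

(** Shifting the coefficient of [X^(d-1)] by [- t] permutes the monic polynomials of degree [d] and
    multiplies each value by [e t], which is not 1. As [d - 1 >= 2], the two lowest coefficients
    stay fixed. *)
Lemma kl_sum_ge3 d : (3 <= d)%N -> char_sum kl_char d = 0.
Proof.
move=> d_ge3; have [t et] := exists_e_chr_neq1.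
pose shift f : {poly F} := f - t *: 'X^(d.-1).
have shift_coef f i : (i < d.-1)%N -> (shift f)`_i = f`_i.
  by move=> lt_id; rewrite !coefE ltn_eqF // mulr0 subr0.
have size_low : (size (t *: 'X^(d.-1) : {poly F}) <= d)%N.
  by apply: leq_trans (size_scale_leq _ _) _;
    rewrite size_polyXn prednK // (leq_trans _ d_ge3).
have perm_shift : perm_eq (monics d) (map shift (monics d)).
  have inj_shift : injective shift by move=> f g /addIr.
  have uniq_shift : uniq (map shift (monics d)) by rewrite map_inj_uniq
    ?uniq_monics.
  have sub_shift : {subset map shift (monics d) <= monics d}.
    move=> _ /mapP[f + ->]; rewrite !mem_monics => /andP[mf /eqP sf].
    have lt_low : (size (- (t *: 'X^(d.-1)))%R < size f)%N by rewrite
      size_polyN sf ltnS.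
    by rewrite /shift monicE lead_coefDl // size_polyDl // sf eqxx (monicP mf)
      eqxx.
  rewrite perm_sym; apply: uniq_perm; rewrite ?uniq_monics //.
  by have [] := uniq_min_size uniq_shift sub_shift; rewrite ?size_map.
have shift_char f : f \in monics d -> kl_char (shift f) = e t * kl_char f.
  move=> md; have : shift f \in monics d by rewrite (perm_mem perm_shift) map_f.
  move: md; rewrite !mem_monics => /andP[_ /eqP sf] /andP[_ /eqP ssf].
  rewrite /kl_char /logder0 !shift_coef; try by lia.
  case: ifP => _; first by rewrite mulr0.
  rewrite -e_chrD /subcoef sf ssf !coefXM gtn_eqF ?(leq_trans _ d_ge3) //=.
  by rewrite !coefE eqxx mulr1; congr e; ring.
have : char_sum kl_char d = e t * char_sum kl_char d.
  rewrite {1}/char_sum (perm_big _ perm_shift) big_map mulr_sumr.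
  by rewrite big_seq [RHS]big_seq; apply: eq_bigr.
move/eqP; rewrite -subr_eq0 -{1}[char_sum _ _]mul1r -mulrBl mulf_eq0.
by rewrite subr_eq0 eq_sym (negPf et) => /eqP.
Qed.

End Kloosterman.
End AdditiveCharacter.

(** * The lifting relation *)

Section Lifting.
Context {m n : nat} {F L : finFieldType} (iota : {rmorphism F -> L}).
Context {w : algC} {a : F}.
Hypothesis m_ge2 : (2 <= m)%N.
Hypothesis n_gt0 : (0 < n)%N.
Hypothesis cardF : #|F| = (3 ^ m)%N.
Hypothesis cardL : #|L| = (3 ^ (m * n))%N.
Hypothesis w3 : 3.-primitive_root w.
Hypothesis nza : a != 0.

Let m_gt0 : (0 < m)%N := ltnW m_ge2.
Local Notation chi := (@kl_char F w m a).
Local Notation M := (prime_power_sum chi n).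

(** Both sides obey the same recurrence of order 2: on the left by the Newton identities, where
    [char_sum] vanishes from degree 3 on, and on the right by Cayley-Hamilton. *)
Lemma prime_power_sum_trace (A : 'M[int]_2) d :
  \det A = (3 ^ m)%:Z -> (\tr A)%:~R = 1 - Kloost w m a ->
  (0 < d <= n)%N -> M d = - (\tr (A ^+ d))%:~R.
Proof.
move=> detA trA.
have S0 : char_sum chi 0 = 1 by apply: kl_sum0.
have S1 : char_sum chi 1 = Kloost w m a - 1 by apply: kl_sum1.
have S2 : char_sum chi 2 = (3 ^ m)%:R by apply: kl_sum2.
have S3 k : (3 <= k)%N -> char_sum chi k = 0 by apply: kl_sum_ge3.
have newton k : (k <= n)%N ->
    char_sum chi k *+ k = \sum_(j < k.+1) M j * char_sum chi (k - j).
  by apply: mulrn_char_sum; [apply: kl_char1 | apply: kl_charM].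
have M0 : M 0 = 0 by have := newton _ (leq0n n); rewrite big_ord1 S0 mulr1.
pose tr d := - (\tr (A ^+ d))%:~R : algC.
have tr1 : tr 1 = Kloost w m a - 1 by rewrite /tr expr1 trA opprB.
have trS k : tr k.+2 = - ((Kloost w m a - 1) * tr k.+1 + (3 ^ m)%:R * tr k).
  by rewrite /tr mxtrace_exp_rec rmorphB !rmorphM /= detA trA; ring.
have M1 : (0 < n)%N -> M 1 = tr 1.
  move=> le1n; have := newton _ le1n; rewrite big_ord_recr big_ord1 /= subnn S0.
  by rewrite M0 mul0r add0r mulr1 mulr1n S1 tr1.
suff IH k : ((k < n)%N -> M k.+1 = tr k.+1) /\ ((k.+1 < n)%N -> M k.+2 = tr
  k.+2).
  by case: d => // d /= lt_dn; have [->] := IH d.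
elim: k => [|k [IH1 IH2]].
  split=> // le2n; have := newton _ le2n.
  rewrite !big_ord_recr big_ord0 /= subnn S0 M0 S1 S2 M1 ?(ltnW le2n) //.
  (* Here [tr 0 = - 2], from the trace of the identity, matches the term [2 * q] produced by the
     degree weight of [char_sum chi 2]. *)
  rewrite trS tr1 /tr expr0 mxtrace1 => eqM.
  have -> : M 2 = (3 ^ m)%:R *+ 2 - tr 1 * (Kloost w m a - 1).
    by rewrite eqM tr1; ring.
  by rewrite tr1; ring.
split=> // lt_kn; have := newton _ lt_kn.
rewrite 3!big_ord_recr /= subnn S0.
have -> : (k.+3 - k.+2 = 1)%N by lia.
have -> : (k.+3 - k.+1 = 2)%N by lia.
rewrite S1 S2 S3 // mul0rn big1 => [|i _]; last first.
  by rewrite S3 ?mulr0 //; have := ltn_ord i; lia.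
rewrite IH1 ?IH2; try by lia.
rewrite add0r mulr1 => /esym/eqP; rewrite addrC addr_eq0 => /eqP ->.
by rewrite [in RHS]trS; ring.
Qed.

Let cardL_q : #|L| = (#|F| ^ n)%N.
Proof. by rewrite cardL cardF expnM. Qed.

Let q_pchar : [pchar L].-nat #|F|.
Proof.
have pcharL : 3 \in [pchar L] by apply: card_finPcharP cardL _.
by rewrite cardF pnatX pnatE ?pcharL.
Qed.

Lemma relTr_orbit e (y : L) : y ^+ (#|F| ^ e) = y -> (e %| n)%N ->
  relTr #|F| n y = (\sum_(j < e) y ^+ (#|F| ^ j)) *+ (n %/ e).
Proof.
move=> ye /dvdnP[k ->]; have [->|e_gt0] := posnP e.
  by rewrite muln0 divn0 /relTr big_ord0.
rewrite mulnK // /relTr; elim: k => [|k IHk]; first by rewrite mul0n big_ord0.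
rewrite mulSn big_split_ord /= mulrS; congr (_ + _).
rewrite -IHk; apply: eq_bigr => i _; by rewrite expnD exprM ye.
Qed.

(** The relative trace of [x + a / x] is [n / e] times its sum over one Frobenius orbit, which is
    read off the coefficients of [P] because [P] is the orbit polynomial. The value 0 at [x = 0]
    matches [chi X = 0]. *)
Lemma e_chr_n_irred e (P : {poly F}) (x : L) : P \in irreds e ->
  root (map_poly iota P) x -> (e %| n)%N ->
  (if x == 0 then 0 else e_chr_n w m n (x + iota a / x)) =
  chi P ^+ (n %/ e).
Proof.
move=> irrP Px dvd_en.
have PE := irred_root_orbit q_pchar irrP Px.
have xe := irred_root_frob irrP Px.
have coef0P : iota P`_0 = (map_poly iota P)`_0 by rewrite coef_map.
have [x0|nzx] := eqVneq x 0.
  have P0 : P`_0 = 0.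
    by apply/eqP; rewrite -(fmorph_eq0 iota) coef0P -horner_coef0; move: Px;
      rewrite x0.
  have ne_gt0 : (0 < n %/ e)%N.
    by rewrite divn_gt0 ?(dvdn_gt0 n_gt0 dvd_en) // dvdn_leq.
  by rewrite /kl_char P0 eqxx expr0n eqn0Ngt ne_gt0.
have nzxj j : x ^+ (#|F| ^ j) != 0 by rewrite expf_neq0.
have nzP0 : P`_0 != 0.
  rewrite -(fmorph_eq0 iota) coef0P PE -horner_coef0 horner_prod.
  by apply/prodf_neq0 => j _; rewrite !hornerE oppr_eq0.
pose c := - (subcoef P + a * logder0 P).
have iota_c : iota c = \sum_(j < e) (x + iota a / x) ^+ (#|F| ^ j).
  rewrite rmorphN rmorphD rmorphM /=.
  have -> : iota (subcoef P) = subcoef (map_poly iota P).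
    rewrite /subcoef size_map_poly.
    by rewrite -coef_map rmorphM /= map_polyX.
  have -> : iota (logder0 P) = logder0 (map_poly iota P).
    by rewrite /logder0 fmorph_div !coef_map.
  rewrite PE subcoef_prod logder0_prod // mulrN opprD !opprK mulr_sumr
    -big_split.
  apply: eq_bigr => j _ /=; rewrite exprDn_pchar ?pnatX ?q_pchar // exprMn
    exprVn.
  congr (_ + _ * _); rewrite -rmorphXn /=; congr (iota _).
  by rewrite expn_iter_fixed // expf_card.
have ye : (x + iota a / x) ^+ (#|F| ^ e) = x + iota a / x.
  rewrite exprDn_pchar ?pnatX ?q_pchar // exprMn exprVn xe -rmorphXn /=.
  by rewrite expn_iter_fixed // expf_card.
rewrite /kl_char (negPf nzP0) -/c -e_chrMn // /e_chr_n /e_chr -cardF.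
rewrite (relTr_orbit ye dvd_en) -iota_c -rmorphMn /=; congr (w ^+ _).
have -> : absTr m (iota (c *+ (n %/ e))) = iota (absTr m (c *+ (n %/ e))).
  by rewrite /absTr rmorph_sum; apply: eq_bigr => j _; rewrite rmorphXn.
by rewrite /f3_exp fmorph_eq0 fmorph_eq1.
Qed.

Lemma Kloost_n_prime_power_sum : Kloost_n iota w m n a = 1 + M n.
Proof.
rewrite /Kloost_n (bigD1 0) //= invr0 mulr0 addr0; congr (_ + _).
  rewrite /e_chr_n /relTr big1 => [|j _]; last first.
    by rewrite expr0n expn_eq0 -leqn0 leqNgt expn_gt0.
  by rewrite /absTr big1 /f3_exp ?eqxx // => j _; rewrite expr0n expn_eq0.
transitivity
  (\sum_(x : L) if x == 0 then 0 else e_chr_n w m n (x + iota a / x)).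
  by rewrite big_mkcond; apply: eq_bigr => x _; case: eqP.
rewrite (sum_over_irreds (iota := iota) q_pchar cardL_q n_gt0
  (H := fun e P => chi P ^+ (n %/ e))); last first.
  by move=> x e P irrP Px dvd_en; apply: e_chr_n_irred.
rewrite /prime_power_sum big_mkcond /=; apply: eq_bigr => e _.
case: ifPn => [dvd_en|ndvd_en]; last first.
  rewrite big1 // => P _; rewrite big1 // => k /eqP nE.
  by case/negP: ndvd_en; apply/dvdnP; exists k; rewrite mulnC nE.
have e_gt0 := dvdn_gt0 n_gt0 dvd_en.
apply: eq_bigr => P _; rewrite (big_nat_widenl _ 0) //= big_mkord.
have lt_ne : (n %/ e < n.+1)%N by rewrite ltnS leq_div.
(* The condition [e * k = n] leaves the single index [k = n / e]. *)
rewrite (big_pred1 (Ordinal lt_ne)) // => k.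
rewrite mulnC -eqn_div // -[RHS](inj_eq val_inj) /=; case: eqP => //= ->.
by rewrite divn_gt0 // dvdn_leq.
Qed.

Lemma Kloost_n_trace (A : 'M[int]_2) :
  \det A = (3 ^ m)%:Z -> (\tr A)%:~R = 1 - Kloost w m a ->
  Kloost_n iota w m n a = 1 - (\tr (A ^+ n))%:~R.
Proof.
by move=> detA trA; rewrite Kloost_n_prime_power_sum (prime_power_sum_trace
  detA trA) // n_gt0 leqnn.
Qed.

End Lifting.

(** * Valuations of integers and the final comparison *)

Lemma exists_mx2 (R : comNzRingType) (t d : R) :
  exists A : 'M[R]_2, \tr A = t /\ \det A = d.
Proof.
(* The companion matrix of [X^2 - t X + d]. *)
exists (\matrix_(i, j) if i == 0 then (if j == 0 then 0 else - d)
                        else (if j == 0 then 1 else t)).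
by rewrite mxtrace2 det_mx2 !mxE /=; split; ring.
Qed.

(** A rational algebraic integer is an integer, so [dvd3] on integers is ordinary divisibility. *)
Lemma is_val3_int M (z : int) : z != 0 -> is_val3 M z%:~R (logn 3 `|z|).
Proof.
move=> nz; have dvd3E k : dvd3 k z%:~R <-> (k <= logn 3 `|z|)%N.
  rewrite -pfactor_dvdn ?absz_gt0 // -[(3 ^ k)%N]/(absz (3 ^ k)%N) -dvdzE.
  have nz3 : 3%:R ^+ k != 0 :> algC by rewrite expf_neq0 ?pnatr_eq0.
  have pow3E : 3%:R ^+ k = (3 ^ k)%N%:Z%:~R :> algC by rewrite -natrX.
  split=> [Aint_q|/dvdzP[u ->]].
    have /intrP[u uE] : z%:~R / 3%:R ^+ k \is a @Num.int algC.
      apply: Cint_rat_Aint => //; rewrite rpred_div ?rpredX ?rpred_nat //.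
      exact: rpred_int.
    apply/dvdzP; exists u; apply: (@intr_inj algC).
    by rewrite rmorphM /= -uE -pow3E divfK.
  by rewrite /dvd3 rmorphM /= -pow3E mulfK ?Aint_int.
rewrite /is_val3 intr_eq0 (negPf nz); split; first exact/dvd3E.
by move=> j /dvd3E.
Qed.

(** The ultrametric rule: adding a multiple of a higher power of 3 keeps the valuation. *)
Lemma logn_abszD (x y : int) : x != 0 -> (3 ^+ (logn 3 `|x|).+1 %| y)%Z ->
  (x + y != 0) /\ logn 3 `|x + y| = logn 3 `|x|.
Proof.
move=> nzx dvd_y; have dvdE (z : int) k : z != 0 ->
    (3 ^+ k %| z)%Z = (k <= logn 3 `|z|)%N.
  by move=> nz; rewrite -pfactor_dvdn ?absz_gt0 // dvdzE abszX.
have ndvd : ~~ (3 ^+ (logn 3 `|x|).+1 %| x + y)%Z.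
  by rewrite (rpredDr _ dvd_y) dvdE // ltnn.
have nzxy : x + y != 0 by apply: contraNneq ndvd => ->; rewrite dvdz0.
split=> //; apply/eqP; rewrite eqn_leq leqNgt -!(dvdE (x + y)) // ndvd /=.
apply: rpredD; first by rewrite [_ \in _]dvdE.
by apply: dvdz_trans dvd_y; rewrite exprS dvdz_mull.
Qed.

(* F = F_q with q = 3^m, L = F_{q^n}, iota : F_q -> F_{q^n} the inclusion,
   w a primitive cube root of unity.  Conclusion: H(a) exists and
   H_n(a) = H(a) + h. *)
Theorem theorem2 (m n h s : nat) (F L : finFieldType)
    (iota : {rmorphism F -> L}) (w : algC) (a : F) :
  (2 <= m)%N -> #|F| = (3 ^ m)%N -> #|L| = (3 ^ (m * n))%N ->
  (2 <= n)%N -> n = (3 ^ h * s)%N -> coprime s 3 ->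
  3.-primitive_root w -> a != 0 ->
  exists k : nat,
    is_val3 m (Kloost w m a) k /\
    is_val3 (m * n) (Kloost_n iota w m n a) (k + h).
Proof.
move=> m_ge2 cardF cardL n_ge2 nE co_s w3 nza.
have m_gt0 := ltnW m_ge2; have n_gt0 := ltnW n_ge2.
have [B [B_gt0 B_lt KE]] := Kloost_int m_gt0 cardF w3 nza m_ge2.
have [r qE] : exists r, (3 ^ m = 9 * r)%N.
  by exists (3 ^ (m - 2))%N; rewrite -(expnD 3 2) subnKC.
pose q := (3 ^ m)%N%:Z; pose K := q - (3 * B)%N%:Z.
have [A [trA detA]] := exists_mx2 (1 - K) q.
have KzE : Kloost w m a = K%:~R by rewrite KE /K rmorphB.
have trAE : (\tr A)%:~R = 1 - Kloost w m a by rewrite trA KzE rmorphB.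
pose N k := \det (1 - A ^+ k).
have N1E : N 1%N = K + q.
  by rewrite /N expr1 det_one_sub_mx2 trA detA; ring.
have NnE : N n - q ^+ n = 1 - \tr (A ^+ n).
  by rewrite /N det_one_sub_mx2 det_mxX detA addrK.
have KnE : Kloost_n iota w m n a = (N n - q ^+ n)%:~R.
  rewrite (Kloost_n_trace iota m_ge2 n_gt0 cardF cardL w3 nza detA trAE).
  by rewrite NnE rmorphB.
(* [K + q = 2 q - 3 B] is positive because [2 B < q]. *)
have nzN1 : N 1%N != 0 by rewrite N1E /K /q; apply/eqP; lia.
have tr3 : (3 %| \tr A - 1)%Z.
  by apply/dvdzP; exists (B%:Z - 3 * r%:Z); rewrite trA /K /q qE; lia.
have det9 : (9 %| \det A)%Z.
  by apply/dvdzP; exists r%:Z; rewrite detA /q qE mulnC.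
have valN : logn 3 `|N n| = (logn 3 `|N 1%N| + h)%N.
  by rewrite /N nE expr1 logn_det_one_subX // -[A]expr1.
pose v := logn 3 `|N 1%N|.
(* Positivity of [v] excludes [N n = 0] below: [logn] takes the default value 0 at 0, while [valN]
   gives [v + h]. *)
have v_gt0 : (0 < v)%N.
  rewrite /v -pfactor_dvdn ?absz_gt0 // -[(3 ^ 1)%N]/(absz 3) -dvdzE.
  by apply/dvdzP; exists (6 * r%:Z - B%:Z); rewrite N1E /K /q qE; lia.
have qX : q = 3 ^+ m by rewrite -[LHS]natz natrX.
have [v_le valK] : (v <= m)%N /\ is_val3 m K%:~R v.
  (* For [K = 0] the valuation of [K + q] is [m], the conventional value of [H]. Otherwise
     [- q / 2 < K < q], so [q] does not divide [K] and adding [q] keeps the valuation. *)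
  have [K0|nzK] := eqVneq K 0.
    have -> : v = m by rewrite /v N1E K0 add0r pfactorK.
    by rewrite K0 /is_val3 eqxx.
  have lt_K : (logn 3 `|K| < m)%N.
    rewrite ltnNge -pfactor_dvdn ?absz_gt0 //; apply/negP.
    move=> /dvdn_leq; rewrite absz_gt0 => /(_ nzK); rewrite /K /q.
    move: (3 ^ m)%N B_lt => Q B_lt; lia.
  have [_ vE] : K + q != 0 /\ logn 3 `|K + q| = logn 3 `|K|.
    by apply: logn_abszD => //; rewrite qX dvdz_exp2l.
  by rewrite /v N1E vE; split; [apply: ltnW | apply: is_val3_int].
exists v; rewrite KzE KnE; split=> //.
(* This makes the valuation of [N n] smaller than that of [q ^+ n], so subtracting [q ^+ n] keeps
   it. It follows from [v <= m], [h < n] and [m, n >= 2]. *)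
have lt_val : (v + h < m * n)%N.
  have lt_h : (h < n)%N.
    rewrite nE; apply: leq_trans (ltn_expl h (isT : 1 < 3)%N) _.
    by rewrite leq_pmulr //; case: s co_s {nE}.
  nia.
have nzNn : N n != 0.
  apply: contraTneq v_gt0 => Nn0; rewrite -eqn0Ngt.
  by move/esym/eqP: valN; rewrite Nn0 logn0 addn_eq0 => /andP[].
have [nzKn vE] : N n - q ^+ n != 0 /\ logn 3 `|N n - q ^+ n| = logn 3 `|N n|.
  apply: logn_abszD => //; rewrite rpredN valN qX -exprM.
  exact: dvdz_exp2l.
by rewrite -[X in is_val3 _ _ X]valN -vE; apply: is_val3_int.
Qed.
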